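(* Let $(\omega_0,g_0)$ be an almost-hermitian structure on a real vector space $\mathfrak g$ of dimension $2n$ and let $\mu(t)$ be a $(p,q)$-bracket flow solution, $\frac{d}{dt}\mu=\delta_\mu(P_\mu+Q_\mu^{ac})$, of Lie brackets on $\mathfrak g$. Write $P=P_{\mu(t)}$, $Q=Q_{\mu(t)}$, $B=B_{\mu(t)}$, $H=H_{\mu(t)}$, $M=M_{\mu(t)}$. (i) The Ricci operator $\mathrm{Ric}=\mathrm{Ric}_{\mu(t)}$ of $(G_{\mu(t)},g_0)$ evolves by $$\frac{d}{dt}\mathrm{Ric}=-\tfrac12\Delta(P+Q^{ac})-\tfrac12\big(B(P+Q^{ac})+(P+Q^{ac})^tB\big)-2S\big(\mathrm{ad}_\mu(S(P+Q^{ac})(H))\big)-S\big([\mathrm{ad}_\mu H,P+Q^{ac}]\big),$$ where $\Delta:=S\circ\delta_\mu^t\delta_\mu$. (ii) The scalar curvature $R=R_{\mu(t)}$ of $(G_{\mu(t)},g_0)$ evolves by $$\frac{d}{dt}R=2\langle P+Q^{ac},\mathrm{Ric}\rangle+2\langle P+Q^{ac},S(\mathrm{ad}_\mu H)\rangle-2\langle(P+Q^{ac})H,H\rangle.$$ (iii) $\displaystyle\frac{d}{dt}|\mu|^2=-8\langle P+Q^{ac},M\rangle.$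
   Context: Almost-hermitian structures. On a real vector space $\mathfrak g$ of dimension $2n$, an almost-hermitian structure is a pair $(\omega,g)$, with $\omega$ a non-degenerate $2$-form and $g$ an inner product, such that the operator $J$ defined by $\omega=g(J\cdot,\cdot)$ satisfies $J^2=-I$. For $A\in\mathrm{End}(\mathfrak g)$: $A^{c}:=\frac12(A-JAJ)$, $A^{ac}:=\frac12(A+JAJ)$. The pair $(p,q)$. One fixes a rule assigning to every almost-hermitian structure $(\omega,g)$ on every $2n$-dimensional real Lie algebra a $2$-form $p(\omega,g)$ and a symmetric bilinear form $q(\omega,g)$ on it; operators $P,Q$ are defined by $p=\omega(P\cdot,\cdot)$, $q=g(Q\cdot,\cdot)$. Standing assumptions: invariance under Lie algebra isomorphisms carrying one almost-hermitian structure to another; $P^c=Q^c$; smooth dependence of $P_\mu,Q_\mu$ on $\mu$; $p(c\omega,cg)=p(\omega,g)$ and $q(c\omega,cg)=q(\omega,g)$ for $c>0$. For a Lie bracket $\mu$ on the vector space $\mathfrak g$, $P_\mu,Q_\mu$ are the operators $P,Q$ of $(\omega_0,g_0)$ on the Lie algebra $(\mathfrak g,\mu)$, $Q_\mu^{ac}$ being relative to $J_0$. $G_\mu$ is the simply connected Lie group with Lie algebra $(\mathfrak g,\mu)$, and $g_0$ also denotes the corresponding left-invariant metric. Notation. $\langle\mu,\lambda\rangle:=\sum_{i,j} g_0(\mu(e_i,e_j),\lambda(e_i,e_j))$ on $\Lambda^2\mathfrak g^*\otimes\mathfrak g$ ($\{e_i\}$ any $g_0$-orthonormal basis), $|\mu|^2=\langle\mu,\mu\rangle$;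 $\langle A,B\rangle:=\mathrm{tr}(AB^t)$ on $\mathrm{End}(\mathfrak g)$; $\langle X,Y\rangle=g_0(X,Y)$ on $\mathfrak g$; transposes of operators on $\mathfrak g$ are relative to $g_0$. $\delta_\mu:\mathrm{End}(\mathfrak g)\to\Lambda^2\mathfrak g^*\otimes\mathfrak g$, $\delta_\mu(A):=\mu(A\cdot,\cdot)+\mu(\cdot,A\cdot)-A\mu(\cdot,\cdot)$, and $\delta_\mu^t$ is its adjoint for these inner products. $S(A):=\frac12(A+A^t)$. $M_\mu\in\mathrm{End}(\mathfrak g)$ is defined by $\langle M_\mu,E\rangle=-\frac14\langle\delta_\mu(E),\mu\rangle$ for all $E\in\mathrm{End}(\mathfrak g)$; $B_\mu$ by $g_0(B_\mu X,Y)=\mathrm{tr}(\mathrm{ad}_\mu X\,\mathrm{ad}_\mu Y)$; $H_\mu\in\mathfrak g$ by $g_0(H_\mu,X)=\mathrm{tr}(\mathrm{ad}_\mu X)$. The Ricci operator of $(G_\mu,g_0)$ is $\mathrm{Ric}_\mu=M_\mu-\frac12B_\mu-S(\mathrm{ad}_\mu H_\mu)$ and the scalar curvature is $R_\mu=\mathrm{tr}\,\mathrm{Ric}_\mu=-\frac14|\mu|^2-\frac12\mathrm{tr}\,B_\mu-|H_\mu|^2$. *)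

(* Defs.v *)
From HB Require Import structures.
From mathcomp Require Import all_boot all_order all_algebra.
From mathcomp Require Import boolp classical_sets reals topology normedtype derive.
Set Implicit Arguments.
Unset Strict Implicit.
Unset Printing Implicit Defensive.
Import Order.TTheory GRing.Theory Num.Theory numFieldNormedType.Exports.

Local Open Scope classical_set_scope.
Local Open Scope ring_scope.

(* With this encoding the musical isomorphism of a form [b] is [b] itself, so
   the vector [v] with [b v = phi] is [(b^-1)%VF phi], and the operator [A] with
   [f = b (A _) _] is [(b^-1 \o f)%VF] ; see [nondegK] and [op_ofE]. *)
Definition bform (R : realType) (V : vectType R) := 'Hom(V, 'Hom(V, R^o)).

Definition bform_of (R : realType) (V : vectType R) (f : V -> V -> R) : bform V :=
  linfun (fun X => linfun (f X : V -> R^o)).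

Definition alternating (R : realType) (V : vectType R) (b : bform V) : Prop :=
  forall X : V, b X X = 0.

Definition symm_form (R : realType) (V : vectType R) (b : bform V) : Prop :=
  forall X Y : V, b X Y = b Y X.

Definition nondeg (R : realType) (V : vectType R) (b : bform V) : Prop :=
  forall X : V, (forall Y : V, b X Y = 0) -> X = 0.

Definition inner_product (R : realType) (V : vectType R) (g : bform V) : Prop :=
  symm_form g /\ forall X : V, X != 0 -> 0 < (g X X : R).

Definition op_of (R : realType) (V : vectType R) (b f : bform V) : 'End(V) :=
  (b^-1 \o f)%VF.

(* [omega = g (J _) _]. *)
Definition cplx (R : realType) (V : vectType R) (omega g : bform V) : 'End(V) :=
  op_of g omega.

Definition almost_hermitian (R : realType) (V : vectType R)
    (omega g : bform V) : Prop :=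
  [/\ alternating omega, nondeg omega, inner_product g
    & (cplx omega g \o cplx omega g)%VF = - \1%VF].

Definition cpart (R : realType) (V : vectType R) (J A : 'End(V)) : 'End(V) :=
  2^-1 *: (A - (J \o A \o J)%VF).

Definition acpart (R : realType) (V : vectType R) (J A : 'End(V)) : 'End(V) :=
  2^-1 *: (A + (J \o A \o J)%VF).

(* [mu X Y] is the bracket of [X] and [Y], and [mu X] is the operator ad X. *)
Definition bracket (R : realType) (V : vectType R) := 'Hom(V, 'End(V)).

Definition is_lie (R : realType) (V : vectType R) (mu : bracket V) : Prop :=
  (forall X : V, mu X X = 0) /\
  (forall X Y Z : V, mu X (mu Y Z) + mu Y (mu Z X) + mu Z (mu X Y) = 0).

Definition delta (R : realType) (V : vectType R) (mu : bracket V) (A : 'End(V)) :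
    bracket V :=
  linfun (fun X : V =>
    linfun (fun Y : V => mu (A X) Y + mu X (A Y) - A (mu X Y)) : 'End(V)).

Definition transp (R : realType) (V : vectType R) (g : bform V) (A : 'End(V)) :
    'End(V) :=
  op_of g (bform_of (fun X Y => g X (A Y))).

Definition sympart (R : realType) (V : vectType R) (g : bform V) (A : 'End(V)) :
    'End(V) :=
  2^-1 *: (A + transp g A).

Definition lftrace (R : realType) (V : vectType R) (A : 'End(V)) : R :=
  \tr (passmx.mxof (vbasis {:V}) (vbasis {:V}) A).

Definition dotE (R : realType) (V : vectType R) (g : bform V) (A B : 'End(V)) : R :=
  lftrace (A \o transp g B)%VF.

Definition orthonormal_basis (R : realType) (V : vectType R) (g : bform V)
    (e : (\dim {:V}).-tuple V) : Prop :=
  forall i j : 'I_(\dim {:V}), g e`_i e`_j = (i == j)%:R.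

Definition onb (R : realType) (V : vectType R) (g : bform V) :
    (\dim {:V}).-tuple V :=
  xget [tuple 0 | _ < \dim {:V}] [set e | orthonormal_basis g e].

(* The value does not depend on the orthonormal basis, see [dotB_basis]. *)
Definition dotB (R : realType) (V : vectType R) (g : bform V) (mu la : bracket V) : R :=
  \sum_(i < \dim {:V}) \sum_(j < \dim {:V})
    g (mu (onb g)`_i (onb g)`_j) (la (onb g)`_i (onb g)`_j).

(* The operator [A] with [dotE g A E = phi E] for all [E], for linear [phi]. *)
Definition rieszE (R : realType) (V : vectType R) (g : bform V)
    (phi : 'End(V) -> R) : 'End(V) :=
  ((bform_of (dotE g))^-1)%VF (linfun (phi : _ -> R^o)).

(* The adjoint of [delta mu], see [deltatE]. *)
Definition deltat (R : realType) (V : vectType R) (g : bform V) (mu la : bracket V) :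
    'End(V) :=
  rieszE g (fun A => dotB g (delta mu A) la).

(* [dotE g (Mop g mu) E = - 1/4 dotB g (delta mu E) mu], see [MopE]. *)
Definition Mop (R : realType) (V : vectType R) (g : bform V) (mu : bracket V) :
    'End(V) :=
  rieszE g (fun E => - 4^-1 * dotB g (delta mu E) mu).

Definition Bop (R : realType) (V : vectType R) (g : bform V) (mu : bracket V) :
    'End(V) :=
  op_of g (bform_of (fun X Y => lftrace (mu X \o mu Y)%VF)).

Definition Hvec (R : realType) (V : vectType R) (g : bform V) (mu : bracket V) : V :=
  (g^-1)%VF (linfun (fun X => lftrace (mu X) : R^o)).

(* Ricci operator of the left-invariant metric defined by [g] on the simply
   connected Lie group with Lie algebra [(V, mu)], in terms of [mu] and [g]. *)
Definition Ric (R : realType) (V : vectType R) (g : bform V) (mu : bracket V) :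
    'End(V) :=
  Mop g mu - 2^-1 *: Bop g mu - sympart g (mu (Hvec g mu)).

Definition scal (R : realType) (V : vectType R) (g : bform V) (mu : bracket V) : R :=
  lftrace (Ric g mu).

Definition Lap (R : realType) (V : vectType R) (g : bform V) (mu : bracket V)
    (A : 'End(V)) : 'End(V) :=
  sympart g (deltat g mu (delta mu A)).

Lemma nondegK (R : realType) (V : vectType R) (b : bform V) :
  nondeg b -> forall phi : 'Hom(V, R^o), b ((b^-1)%VF phi) = phi.
Proof.
move=> nb phi; rewrite limg_lfunVK //.
have kb : lker b == 0%VS.
  apply/lker0P => X Y /eqP; rewrite -subr_eq0 -linearB => /eqP bXY.
  by apply/eqP; rewrite -subr_eq0; apply/eqP/nb => Z; rewrite bXY zero_lfunE.
suff -> : limg b = fullv by rewrite memvf.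
apply/eqP; rewrite eqEdim subvf limg_dim_eq ?(eqP kb) ?capv0 //.
by rewrite !dimvf /dim /= muln1.
Qed.

Lemma linfunE (R : realType) (V W : vectType R) (f : V -> W) :
  linear f -> linfun f =1 f.
Proof.
move=> fL; pose ff := GRing.isLinear.Build R V W *:%R f fL.
pose fl : {linear V -> W} := HB.pack f ff.
exact: (lfunE fl).
Qed.

Lemma bform_ofE (R : realType) (V : vectType R) (f : V -> V -> R) :
  (forall X, linear_for *%R (f X)) -> (forall Y, linear_for *%R (f^~ Y)) ->
  forall X Y, bform_of f X Y = f X Y.
Proof.
move=> fr fl X Y.
have fE Z W : linfun (f Z : V -> R^o) W = f Z W by rewrite linfunE //; exact: fr.
rewrite /bform_of linfunE ?fE // => a Z W; apply/lfunP => T.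
rewrite fE add_lfunE scale_lfunE !fE. exact: fl.
Qed.

Lemma op_ofE (R : realType) (V : vectType R) (b f : bform V) :
  nondeg b -> forall X Y, b (op_of b f X) Y = f X Y.
Proof. by move=> nb X Y; rewrite /op_of lfunE /= nondegK. Qed.

Lemma inner_product_nondeg (R : realType) (V : vectType R) (g : bform V) :
  inner_product g -> nondeg g.
Proof.
move=> [_ gpos] X gX0; apply/eqP/negPn/negP => /gpos.
by rewrite gX0 ltxx.
Qed.

Lemma transpE (R : realType) (V : vectType R) (g : bform V) (A : 'End(V)) :
  inner_product g -> forall X Y, g (transp g A X) Y = g X (A Y).
Proof.
move=> /inner_product_nondeg ng X Y; rewrite op_ofE // bform_ofE // => Z a T W.
  by rewrite !linearP.
by rewrite linearP !lfunE /= !lfunE.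
Qed.

Lemma lftraceE (R : realType) (V : vectType R) (e : (\dim {:V}).-tuple V)
  (A : 'End(V)) : basis_of {:V} e -> lftrace A = \tr (passmx.mxof e e A).
Proof.
move=> be; have bb := vbasisP {:V}.
have -> : passmx.mxof e e A = passmx.mxof e (vbasis {:V}) \1 *m
   passmx.mxof (vbasis {:V}) (vbasis {:V}) A *m passmx.mxof (vbasis {:V}) e \1.
  by rewrite -!passmx.mxof_comp // comp_lfun1r comp_lfun1l.
rewrite mxtrace_mulC mulmxA -passmx.mxof_comp // comp_lfun1l passmx.mxof1 //.
  by rewrite mul1mx.
by case/andP: bb.
Qed.

Lemma orthonormal_basis_of (R : realType) (V : vectType R) (g : bform V)
  (e : (\dim {:V}).-tuple V) : orthonormal_basis g e -> basis_of {:V} e.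
Proof.
move=> oe; rewrite basisEfree subvf size_tuple leqnn !andbT.
apply/freeP => k sk0 i.
have : g (\sum_j k j *: e`_j) e`_i = 0 by rewrite sk0 linear0 zero_lfunE.
rewrite linear_sum sum_lfunE (bigD1 i) //= big1 => [|j ji].
  by rewrite linearZ scale_lfunE oe eqxx addr0 /GRing.scale /= mulr1.
by rewrite linearZ scale_lfunE oe (negPf ji) scaler0.
Qed.

Lemma orthonormal_basis_exists (R : realType) (V : vectType R) (g : bform V) :
  inner_product g -> exists e, orthonormal_basis g e.
Proof.
move=> [gs gpos].
suff H k : (k <= \dim {:V})%N -> exists s : k.-tuple V,
    forall i j : 'I_k, g s`_i s`_j = (i == j)%:R.
  exact: (H _ (leqnn _)).
elim: k => [_|k IH kd]; first by exists [tuple] => -[].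
have [s os] := IH (ltnW kd).
have [v vs] : exists v, v \notin <<s>>%VS.
  apply: contrapT => /forallNP sv.
  have : (\dim {:V} <= \dim <<s>>%VS)%N by apply/dimvS/subvP => x _; apply/negPn/negP/sv.
  by rewrite leqNgt (leq_ltn_trans (dim_span _)) // size_tuple.
pose w := v - \sum_(i < k) g v s`_i *: s`_i.
have wn0 : w != 0.
  apply: contra vs; rewrite subr_eq0 => /eqP ->.
  by apply: memv_suml => i _; rewrite memvZ // memv_span // mem_nth // size_tuple.
have ws (j : 'I_k) : g w s`_j = 0.
  rewrite /w linearB linear_sum !lfunE /= lfunE /= sum_lfunE (bigD1 j) //= big1.
    by rewrite linearZ scale_lfunE os eqxx addr0 /GRing.scale /= mulr1 subrr.
  by move=> i ij; rewrite linearZ scale_lfunE os (negPf ij) scaler0.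
pose r := Num.sqrt (g w w : R).
have r2 : r ^+ 2 = g w w by rewrite sqr_sqrtr // ltW // gpos.
have rn0 : r != 0 by rewrite sqrtr_eq0 -ltNge gpos.
pose u := r^-1 *: w.
have us (j : 'I_k) : g u s`_j = 0 by rewrite /u linearZ scale_lfunE ws scaler0.
exists [tuple of rcons s u] => i j; rewrite !nth_rcons size_tuple.
have [ik|ik] := ltnP i k; have [jk|jk] := ltnP j k.
- exact: (os (Ordinal ik) (Ordinal jk)).
- have -> : (j == k :> nat) by rewrite eqn_leq jk -ltnS ltn_ord.
  rewrite gs (us (Ordinal ik)) -val_eqE /= ltn_eqF //.
  exact: leq_trans ik jk.
- have -> : (i == k :> nat) by rewrite eqn_leq ik -ltnS ltn_ord.
  rewrite (us (Ordinal jk)) -val_eqE /= gtn_eqF //.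
  exact: leq_trans jk ik.
- have ii : (i == k :> nat) by rewrite eqn_leq ik -ltnS ltn_ord.
  have jj : (j == k :> nat) by rewrite eqn_leq jk -ltnS ltn_ord.
  rewrite ii jj -val_eqE /= (eqP ii) (eqP jj) eqxx.
  by rewrite /u !linearZ /= scale_lfunE /GRing.scale /= -r2 expr2 mulKf // mulVf.
Qed.

Lemma onbP (R : realType) (V : vectType R) (g : bform V) :
  inner_product g -> orthonormal_basis g (onb g).
Proof. by move=> /orthonormal_basis_exists [e oe]; exact: (xgetPex _ (ex_intro _ e oe)). Qed.

Lemma coord_orthonormal (R : realType) (V : vectType R) (g : bform V)
  (e : (\dim {:V}).-tuple V) : orthonormal_basis g e ->
  forall i X, coord e i X = g X e`_i.
Proof.
move=> oe i X; rewrite [in RHS](coord_basis (orthonormal_basis_of oe) (memvf X)).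
rewrite linear_sum sum_lfunE (bigD1 i) //= big1 => [|j ji].
  by rewrite linearZ scale_lfunE oe eqxx addr0 /GRing.scale /= mulr1.
by rewrite linearZ scale_lfunE oe (negPf ji) scaler0.
Qed.

Lemma lftrace_onb (R : realType) (V : vectType R) (g : bform V)
  (e : (\dim {:V}).-tuple V) (A : 'End(V)) : orthonormal_basis g e ->
  lftrace A = \sum_(i < \dim {:V}) (g (A e`_i) e`_i : R).
Proof.
move=> oe; rewrite (lftraceE _ (orthonormal_basis_of oe)).
by apply: eq_bigr => i _; rewrite !mxE /= passmx.vecof_delta (coord_orthonormal oe).
Qed.

Lemma sum_onb (R : realType) (V : vectType R) (g : bform V) (f : V -> V -> R)
  (e : (\dim {:V}).-tuple V) : inner_product g -> orthonormal_basis g e ->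
  (forall X, linear_for *%R (f X)) -> (forall Y, linear_for *%R (f^~ Y)) ->
  \sum_(i < \dim {:V}) f e`_i e`_i = lftrace (op_of g (bform_of f)).
Proof.
move=> ig oe fr fl; rewrite (lftrace_onb _ oe); apply: eq_bigr => i _.
by rewrite op_ofE ?bform_ofE //; exact: inner_product_nondeg.
Qed.

Lemma sum_onb_indep (R : realType) (V : vectType R) (g : bform V) (f : V -> V -> R)
  (d e : (\dim {:V}).-tuple V) : inner_product g ->
  orthonormal_basis g d -> orthonormal_basis g e ->
  (forall X, linear_for *%R (f X)) -> (forall Y, linear_for *%R (f^~ Y)) ->
  \sum_(i < \dim {:V}) f d`_i d`_i = \sum_(i < \dim {:V}) f e`_i e`_i.
Proof. by move=> ig od oe fr fl; rewrite (sum_onb ig od) ?(sum_onb ig oe). Qed.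

Lemma dotB_basis (R : realType) (V : vectType R) (g : bform V)
  (e : (\dim {:V}).-tuple V) (mu la : bracket V) :
  inner_product g -> orthonormal_basis g e ->
  dotB g mu la = \sum_(i < \dim {:V}) \sum_(j < \dim {:V})
    (g (mu e`_i e`_j) (la e`_i e`_j) : R).
Proof.
move=> ig oe; rewrite /dotB; set d := onb g; have od := onbP ig.
have H i : \sum_(j < \dim {:V}) (g (mu d`_i d`_j) (la d`_i d`_j) : R) =
    \sum_(j < \dim {:V}) (g (mu d`_i e`_j) (la d`_i e`_j) : R).
  apply: (sum_onb_indep (f := fun Y Z => g (mu d`_i Y) (la d`_i Z)) ig od oe).
  - by move=> Y a Z T; rewrite !linearP.
  - by move=> Y a Z T; rewrite !linearP /= add_lfunE scale_lfunE.
under eq_bigr do rewrite H.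
apply: (sum_onb_indep ig od oe
  (f := fun X X' => \sum_(j < \dim {:V}) g (mu X e`_j) (la X' e`_j))).
all: move=> X a Y Z; rewrite mulr_sumr -big_split; apply: eq_bigr => j _ /=.
all: by rewrite !(linearP, add_lfunE, scale_lfunE).
Qed.

Lemma dotE_onb (R : realType) (V : vectType R) (g : bform V)
  (e : (\dim {:V}).-tuple V) (A B : 'End(V)) :
  inner_product g -> orthonormal_basis g e ->
  dotE g A B = \sum_(i < \dim {:V}) (g (A e`_i) (B e`_i) : R).
Proof.
move=> ig oe.
have -> : dotE g A B = lftrace (transp g B \o A)%VF.
  have bb := vbasisP {:V}.
  by rewrite /dotE /lftrace !(passmx.mxof_comp _ _ bb) // mxtrace_mulC.
by rewrite (lftrace_onb _ oe); apply: eq_bigr => i _; rewrite comp_lfunE transpE.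
Qed.

Lemma dotE_form (R : realType) (V : vectType R) (g : bform V) :
  inner_product g -> forall A B, bform_of (dotE g) A B = dotE g A B.
Proof.
move=> ig; have oe := onbP ig.
apply: bform_ofE => A a B C; rewrite !(dotE_onb _ _ ig oe) mulr_sumr -big_split.
all: by apply: eq_bigr => j _ /=; rewrite !(linearP, add_lfunE, scale_lfunE).
Qed.

Lemma dotE_inner_product (R : realType) (V : vectType R) (g : bform V) :
  inner_product g -> inner_product (bform_of (dotE g)).
Proof.
move=> ig; have oe := onbP ig; split=> [A B|A An0]; rewrite !dotE_form //.
  by rewrite !(dotE_onb _ _ ig oe); apply: eq_bigr => i _; case: ig => + _; apply.
rewrite (dotE_onb _ _ ig oe) lt0r sumr_ge0 ?andbT => [|i _]; last first.
  have [->|/(proj2 ig)/ltW//] := eqVneq (A (onb g)`_i) 0.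
  by rewrite linear0.
apply: contra An0; rewrite psumr_eq0 => [/allP A0|i _]; last first.
  have [->|/(proj2 ig)/ltW//] := eqVneq (A (onb g)`_i) 0.
  by rewrite linear0.
apply/eqP/lfunP => X; rewrite zero_lfunE (coord_basis (orthonormal_basis_of oe) (memvf X)).
rewrite linear_sum big1 // => i _; rewrite linearZ /=.
have [->|/(proj2 ig)] := eqVneq (A (onb g)`_i) 0; first by rewrite scaler0.
by have := A0 i (mem_index_enum _) => /= /eqP ->; rewrite ltxx.
Qed.

Lemma rieszEP (R : realType) (V : vectType R) (g : bform V) (phi : 'End(V) -> R) :
  inner_product g -> linear_for *%R phi ->
  forall A, dotE g (rieszE g phi) A = phi A.
Proof.
move=> ig lphi A; rewrite -dotE_form // nondegK ?linfunE //.
exact/inner_product_nondeg/dotE_inner_product.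
Qed.

Lemma scale_add3 (R : realType) (W : vectType R) (a : R) (x y z w s t : W) :
  (a *: x + y) + (a *: z + w) + (a *: s + t) = a *: (x + z + s) + (y + w + t).
Proof. by rewrite !scalerDr [X in X + _ = _]addrACA [LHS]addrACA. Qed.

Lemma deltaE (R : realType) (V : vectType R) (mu : bracket V) (A : 'End(V)) (X Y : V) :
  delta mu A X Y = mu (A X) Y + mu X (A Y) - A (mu X Y).
Proof.
have H Z T : linfun (fun Y : V => mu (A Z) Y + mu Z (A Y) - A (mu Z Y)) T
    = mu (A Z) T + mu Z (A T) - A (mu Z T).
  rewrite linfunE // => a U W.
  rewrite !linearP /=.
  exact: scale_add3.
rewrite linfunE ?H // => a Z W; apply/lfunP => T; rewrite add_lfunE scale_lfunE !H.
rewrite !(linearP, add_lfunE, scale_lfunE) /= .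
rewrite ?opprD -?scalerN; exact: scale_add3.
Qed.

Lemma dotB_linear (R : realType) (V : vectType R) (g : bform V) (mu la : bracket V) :
  linear_for *%R (fun A => dotB g (delta mu A) la : R).
Proof.
move=> a A C; rewrite /dotB mulr_sumr -big_split; apply: eq_bigr => i _ /=.
rewrite mulr_sumr -big_split; apply: eq_bigr => j _ /=.
have -> X Y : delta mu (a *: A + C) X Y = a *: delta mu A X Y + delta mu C X Y.
  rewrite !deltaE !(linearP, add_lfunE, scale_lfunE) /=.
  rewrite ?opprD -?scalerN; exact: scale_add3.
by rewrite !(linearP, add_lfunE, scale_lfunE).
Qed.

Lemma deltatE (R : realType) (V : vectType R) (g : bform V) (mu la : bracket V) :
  inner_product g ->
  forall A, dotE g (deltat g mu la) A = dotB g la (delta mu A).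
Proof.
move=> ig A; rewrite rieszEP //; last exact: dotB_linear.
by apply: eq_bigr => i _; apply: eq_bigr => j _; case: ig => + _; apply.
Qed.

Lemma MopE (R : realType) (V : vectType R) (g : bform V) (mu : bracket V) :
  inner_product g ->
  forall E, dotE g (Mop g mu) E = - 4^-1 * dotB g (delta mu E) mu.
Proof.
move=> ig E; rewrite rieszEP // => a A C.
by rewrite dotB_linear mulrDr mulrCA.
Qed.

Lemma lftrace_linear (R : realType) (V : vectType R) :
  linear_for *%R (@lftrace R V).
Proof. by move=> a A C; rewrite /lftrace passmx.mxof_linear mxtraceD mxtraceZ. Qed.

Lemma BopE (R : realType) (V : vectType R) (g : bform V) (mu : bracket V) :
  inner_product g ->
  forall X Y, g (Bop g mu X) Y = lftrace (mu X \o mu Y)%VF.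
Proof.
move=> ig X Y; rewrite op_ofE; last exact: inner_product_nondeg.
rewrite bform_ofE // => Z a T W.
  by rewrite linearP comp_lfunDr -comp_lfunZr lftrace_linear.
by rewrite linearP comp_lfunDl -comp_lfunZl lftrace_linear.
Qed.

Lemma HvecE (R : realType) (V : vectType R) (g : bform V) (mu : bracket V) :
  inner_product g -> forall X, g (Hvec g mu) X = lftrace (mu X).
Proof.
move=> ig X; rewrite nondegK ?linfunE //; last exact: inner_product_nondeg.
by move=> a Z W; rewrite linearP lftrace_linear.
Qed.

(* A [vectType] carries no topology: derivatives and smoothness are those of the
   coordinates in a basis, in the normed space of row vectors. *)
Definition crd (R : realType) (W : vectType R) (w : W) : 'rV[R]_(\dim {:W}) :=
  passmx.rVof (vbasis {:W}) w.

Definition has_deriv (R : realType) (W : vectType R) (c : R -> W) (t : R) (w : W) :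
    Prop :=
  is_derive (t : R^o) (1 : R^o) (fun s : R^o => crd (c s)) (crd w).

(* C^k on an open set [U]; in finite dimension it suffices to require continuity
   of the iterated directional derivatives of top order. *)
Fixpoint Ck (R : realType) (m l k : nat) (U : set 'rV[R]_m)
    (f : 'rV[R]_m -> 'rV[R]_l) : Prop :=
  if k is k'.+1 then
    (forall x v, U x -> derivable f x v) /\ (forall v, Ck k' U ('D_v f))
  else forall x, U x -> {for x, continuous f}.

(* [L] need not be open: [F] extends smoothly near every point of [L]. *)
Definition smooth_on (R : realType) (X Y : vectType R) (L : set X) (F : X -> Y) :
    Prop :=
  forall x, L x -> exists (U : set 'rV[R]_(\dim {:X}))
      (f : 'rV[R]_(\dim {:X}) -> 'rV[R]_(\dim {:Y})),
    [/\ open U, U (crd x), (forall k, Ck k U f)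
      & forall y, L y -> U (crd y) -> crd (F y) = f (crd y)].

Definition iso_ah (R : realType) (V W : vectType R)
    (mu : bracket V) (omega g : bform V) (mu' : bracket W) (omega' g' : bform W)
    (phi : 'Hom(V, W)) : Prop :=
  [/\ bijective phi,
      (forall X Y : V, phi (mu X Y) = mu' (phi X) (phi Y)),
      (forall X Y : V, omega' (phi X) (phi Y) = omega X Y)
    & (forall X Y : V, g' (phi X) (phi Y) = g X Y)].

Definition ah_lie (R : realType) (n : nat) (V : vectType R)
    (mu : bracket V) (omega g : bform V) : Prop :=
  [/\ \dim {:V} = n.*2, is_lie mu & almost_hermitian omega g].

(* The values of [pform] and [qform] matter only on data satisfying [ah_lie]. *)
Record pq_rule (R : realType) (n : nat) := PQRule {
  pform : forall V : vectType R, bracket V -> bform V -> bform V -> bform V;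
  qform : forall V : vectType R, bracket V -> bform V -> bform V -> bform V;
  pform_alt : forall (V : vectType R) (mu : bracket V) (omega g : bform V),
    ah_lie n mu omega g -> alternating (pform mu omega g);
  qform_sym : forall (V : vectType R) (mu : bracket V) (omega g : bform V),
    ah_lie n mu omega g -> symm_form (qform mu omega g);
  pq_invariant : forall (V W : vectType R)
      (mu : bracket V) (omega g : bform V)
      (mu' : bracket W) (omega' g' : bform W) (phi : 'Hom(V, W)),
    ah_lie n mu omega g -> ah_lie n mu' omega' g' ->
    iso_ah mu omega g mu' omega' g' phi ->
    forall X Y : V,
      pform mu' omega' g' (phi X) (phi Y) = pform mu omega g X Y /\
      qform mu' omega' g' (phi X) (phi Y) = qform mu omega g X Y;
  pq_cpart : forall (V : vectType R) (mu : bracket V) (omega g : bform V),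
    ah_lie n mu omega g ->
    cpart (cplx omega g) (op_of omega (pform mu omega g)) =
    cpart (cplx omega g) (op_of g (qform mu omega g));
  pq_smooth : forall (V : vectType R) (omega g : bform V),
    \dim {:V} = n.*2 -> almost_hermitian omega g ->
    smooth_on [set mu : bracket V | is_lie mu]
      (fun mu => op_of omega (pform mu omega g)) /\
    smooth_on [set mu : bracket V | is_lie mu]
      (fun mu => op_of g (qform mu omega g));
  pq_scale : forall (V : vectType R) (mu : bracket V) (omega g : bform V) (c : R),
    ah_lie n mu omega g -> 0 < c ->
    pform mu (c *: omega) (c *: g) = pform mu omega g /\
    qform mu (c *: omega) (c *: g) = qform mu omega g
}.

Definition Pop (R : realType) (n : nat) (pq : pq_rule R n) (V : vectType R)
    (omega g : bform V) (mu : bracket V) : 'End(V) :=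
  op_of omega (pform pq mu omega g).

Definition Qop (R : realType) (n : nat) (pq : pq_rule R n) (V : vectType R)
    (omega g : bform V) (mu : bracket V) : 'End(V) :=
  op_of g (qform pq mu omega g).

Definition PQac (R : realType) (n : nat) (pq : pq_rule R n) (V : vectType R)
    (omega g : bform V) (mu : bracket V) : 'End(V) :=
  Pop pq omega g mu + acpart (cplx omega g) (Qop pq omega g mu).

Definition bracket_flow (R : realType) (n : nat) (pq : pq_rule R n)
    (V : vectType R) (omega g : bform V) (I : set R) (mu : R -> bracket V) : Prop :=
  forall t, I t ->
    is_lie (mu t) /\ has_deriv mu t (delta (mu t) (PQac pq omega g (mu t))).

(* Main.v *)
(* Writing A = P + Q^ac, only the equation mu' = delta_mu(A) matters. B, H and
   <M, E> = -1/4 <delta_mu(E), mu> are bilinear, linear and bilinear in mu, so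
   they are differentiated by the product rule. For M one moves the operator
   across, <delta_la(E), mu> = <la, delta_mu(E^t)>, which produces
   -1/2 <delta_mu(A), delta_mu(S(E))> ; for B and H one writes
   ad_{mu'} X = ad(A X) + [ad X, A] and the commutators drop out of the traces,
   giving B' = B A + A^t B and H' = A^t H. The scalar equations follow by taking
   traces, using delta_mu(I) = mu. *)
Require Import Defs.
From mathcomp Require Import all_boot all_order all_algebra.
From mathcomp Require Import boolp classical_sets functions reals topology normedtype derive.
From mathcomp Require Import ring.
Import Order.TTheory GRing.Theory Num.Theory numFieldNormedType.Exports.
Local Open Scope classical_set_scope.
Local Open Scope ring_scope.

Set Implicit Arguments.
Unset Strict Implicit.
Unset Printing Implicit Defensive.

(** * Differentiation of curves in a finite-dimensional space *)

(** Derivability of a row vector is entrywise. This brings the rules below down to those for real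
    functions. *)
Lemma has_derivP (R : realType) (W : vectType R) (c : R -> W) (t : R) (w : W) :
  has_deriv c t w <-> forall i, is_derive (t : R^o) (1 : R^o)
    (fun s : R^o => coord (vbasis {:W}) i (c s) : R^o) (coord (vbasis {:W}) i w).
Proof.
have crdE i : (fun s : R^o => coord (vbasis {:W}) i (c s)) =
    (fun s : R^o => crd (c s) 0 i) by apply/funext => s; rewrite mxE.
split=> [[dc cw] i|dc].
  rewrite crdE; split; first by move/derivable_mxP: dc; exact.
  by have := congr1 (fun M : 'rV_ _ => M 0 i) cw; rewrite derive_mx // !mxE.
have dcrd : derivable (fun s : R^o => crd (c s)) (t : R^o) 1.
  by apply/derivable_mxP => j i; rewrite ord1 -crdE; case: (dc i).
split=> //; rewrite derive_mx //; apply/rowP => i.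
by rewrite !mxE -crdE; case: (dc i).
Qed.

(** Here [f] is a bare function with a linearity proof, so the algebraic lemmas reach it through
    [linfun f]. The shape [a *: (x + y)] is that of [sympart]. *)
Lemma linear_form_scaleD (R : realType) (W : vectType R) (f : W -> R) (a : R) (x y : W) :
  linear_for *%R f -> f (a *: (x + y)) = a * (f x + f y).
Proof. by move=> fl; rewrite -!(linfunE (f := f : W -> R^o) fl) linearZ linearD. Qed.

(** A linear form is a fixed linear combination of the coordinates, whose derivatives are known. *)
Lemma is_derive_linear (R : realType) (W : vectType R) (f : W -> R) (c : R -> W)
    (t : R) (w : W) :
  linear_for *%R f -> has_deriv c t w ->
  is_derive (t : R^o) (1 : R^o) (fun s : R^o => f (c s) : R^o) (f w).
Proof.
move=> fl /has_derivP dc; set e := vbasis {:W}.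
have fE v : f v = \sum_(i < \dim {:W}) f e`_i * coord e i v.
  rewrite -(linfunE (f := f : W -> R^o)) //.
  rewrite {1}(coord_vbasis (memvf v)) linear_sum; apply: eq_bigr => i _.
  by rewrite linearZ /= linfunE // /GRing.scale /= mulrC.
pose h (i : 'I_(\dim {:W})) (s : R^o) : R^o := f e`_i *: (coord e i (c s) : R^o).
rewrite fE (_ : (fun s => _) = \sum_i h i); last first.
  by apply/funext => s; rewrite fct_sumE fE.
by apply: is_derive_sum => i; apply: is_deriveZ.
Qed.

(** Only the first argument is expanded in a basis: each [f e_i] is then a linear form in the second
    one, and the product rule applies to every summand. *)
Lemma is_derive_bilinear (R : realType) (U W : vectType R) (f : U -> W -> R)
    (c : R -> U) (d : R -> W) (t : R) (u : U) (w : W) :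
  (forall x, linear_for *%R (f x)) -> (forall y, linear_for *%R (f^~ y)) ->
  has_deriv c t u -> has_deriv d t w ->
  is_derive (t : R^o) (1 : R^o) (fun s : R^o => f (c s) (d s) : R^o)
    (f u (d t) + f (c t) w).
Proof.
move=> fr fl /has_derivP dc dd; set e := vbasis {:U}.
have fE x y : f x y = \sum_(i < \dim {:U}) coord e i x * f e`_i y.
  rewrite -[LHS](linfunE (f := f^~ y : U -> R^o) (fl y)).
  rewrite {1}(coord_vbasis (memvf x)) linear_sum; apply: eq_bigr => i _.
  by rewrite linearZ /= (linfunE (fl y)).
pose h (i : 'I_(\dim {:U})) (s : R^o) : R^o := coord e i (c s) : R^o.
pose k (i : 'I_(\dim {:U})) (s : R^o) : R^o := f e`_i (d s).
rewrite (_ : (fun s => _) = \sum_i (h i * k i)); last first.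
  by apply/funext => s; rewrite fct_sumE fE.
have dh i : is_derive (t : R^o) (1 : R^o) (h i * k i)
    (h i t *: f e`_i w + k i t *: (coord e i u : R^o)).
  by apply: is_deriveM; exact: (is_derive_linear (fr e`_i) dd).
apply: (is_derive_eq (is_derive_sum dh)).
rewrite (fE u) (fE (c t)) -big_split; apply: eq_bigr => i _ /=.
rewrite addrC; congr (_ + _); exact: mulrC.
Qed.

Lemma has_deriv_linear (R : realType) (W Z : vectType R) (f : W -> Z)
    (c : R -> W) (t : R) (w : W) :
  linear f -> has_deriv c t w -> has_deriv (f \o c) t (f w).
Proof.
move=> fl dc; apply/has_derivP => i.
apply: (is_derive_linear (f := coord _ i \o f) _ dc) => a x y /=.
by rewrite fl linearP.
Qed.

Lemma has_deriv_bilinear (R : realType) (U W Z : vectType R) (f : U -> W -> Z)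
    (c : R -> U) (d : R -> W) (t : R) (u : U) (w : W) :
  (forall x, linear (f x)) -> (forall y, linear (f^~ y)) ->
  has_deriv c t u -> has_deriv d t w ->
  has_deriv (fun s => f (c s) (d s)) t (f u (d t) + f (c t) w).
Proof.
move=> fr fl dc dd; apply/has_derivP => i; rewrite linearD.
apply: (is_derive_bilinear (f := fun x y => coord _ i (f x y)) _ _ dc dd).
  by move=> x a y z /=; rewrite fr linearP.
by move=> y a x z /=; rewrite fl linearP.
Qed.

Lemma has_derivB (R : realType) (W : vectType R) (c d : R -> W) (t : R) (v w : W) :
  has_deriv c t v -> has_deriv d t w -> has_deriv (fun s => c s - d s) t (v - w).
Proof.
move=> /has_derivP dc /has_derivP dd; apply/has_derivP => i.
rewrite linearB (_ : (fun s => _) = (fun s : R^o => coord (vbasis {:W}) i (c s) : R^o)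
  - (fun s : R^o => coord (vbasis {:W}) i (d s) : R^o)); first exact: is_deriveB.
by apply/funext => s /=; rewrite linearB.
Qed.

(** This differentiates objects known only through their pairings, as [Mop], [Bop] and [Hvec]
    are. *)
Lemma has_deriv_nondeg (R : realType) (W : vectType R) (b : bform W)
    (c : R -> W) (t : R) (w : W) :
  nondeg b -> symm_form b ->
  (forall x, is_derive (t : R^o) (1 : R^o) (fun s : R^o => b (c s) x : R^o) (b w x)) ->
  has_deriv c t w.
Proof.
move=> nb sb dc; apply/has_derivP => i.
(* The dual vector of the [i]-th coordinate form: pairing with [x] is taking that coordinate. *)
pose x := (b^-1)%VF (linfun (coord (vbasis {:W}) i : W -> R^o)).
have xE y : coord (vbasis {:W}) i y = b y x.
  by rewrite sb nondegK // linfunE // => a u v; rewrite linearP.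
rewrite xE (_ : (fun s => _) = fun s : R^o => b (c s) x : R^o) //.
by apply/funext => s; rewrite xE.
Qed.

(** * Traces, transposes and the inner product on endomorphisms *)

Lemma lftrace_comm (R : realType) (V : vectType R) (A B : 'End(V)) :
  lftrace (A \o B)%VF = lftrace (B \o A)%VF.
Proof.
by rewrite /lftrace !(passmx.mxof_comp _ _ (vbasisP {:V})) mxtrace_mulC.
Qed.

Lemma lftraceD (R : realType) (V : vectType R) (A B : 'End(V)) :
  lftrace (A + B) = lftrace A + lftrace B.
Proof. by rewrite -[A]scale1r lftrace_linear mul1r scale1r. Qed.

Lemma lftraceZ (R : realType) (V : vectType R) a (A : 'End(V)) :
  lftrace (a *: A) = a * lftrace A.
Proof.
have t0 : lftrace (0 : 'End(V)) = 0.
  by apply: (addIr (lftrace (0 : 'End(V)))); rewrite -lftraceD !add0r.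
by rewrite -[a *: A]addr0 lftrace_linear t0 addr0.
Qed.

Lemma lftraceN (R : realType) (V : vectType R) (A : 'End(V)) :
  lftrace (- A) = - lftrace A.
Proof. by rewrite -scaleN1r lftraceZ mulN1r. Qed.

Lemma lftraceB (R : realType) (V : vectType R) (A B : 'End(V)) :
  lftrace (A - B) = lftrace A - lftrace B.
Proof. by rewrite lftraceD lftraceN. Qed.

Lemma dotEC (R : realType) (V : vectType R) (g : bform V) (A B : 'End(V)) :
  inner_product g -> dotE g A B = dotE g B A.
Proof.
by move=> ig; have [s _] := dotE_inner_product ig; rewrite -!dotE_form.
Qed.

Lemma dotE_linear_r (R : realType) (V : vectType R) (g : bform V) (A : 'End(V)) :
  inner_product g -> linear_for *%R (dotE g A).
Proof. by move=> ig a B C; rewrite -!dotE_form // linearP. Qed.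

Lemma dotE_linear_l (R : realType) (V : vectType R) (g : bform V) (B : 'End(V)) :
  inner_product g -> linear_for *%R (fun A => dotE g A B).
Proof.
by move=> ig a A C; rewrite -!dotE_form // linearP add_lfunE scale_lfunE.
Qed.

Lemma dotEBr (R : realType) (V : vectType R) (g : bform V) (A B C : 'End(V)) :
  inner_product g -> dotE g A (B - C) = dotE g A B - dotE g A C.
Proof. by move=> ig; rewrite -!dotE_form // linearB. Qed.

Lemma dotEZr (R : realType) (V : vectType R) (g : bform V) a (A B : 'End(V)) :
  inner_product g -> dotE g A (a *: B) = a * dotE g A B.
Proof. by move=> ig; rewrite -!dotE_form // linearZ. Qed.

Lemma form_inj (R : realType) (V : vectType R) (g : bform V) (X Y : V) :
  inner_product g -> (forall Z, g X Z = g Y Z) -> X = Y.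
Proof.
move=> ig gXY; apply/eqP; rewrite -subr_eq0; apply/eqP/(inner_product_nondeg ig) => Z.
by rewrite linearB add_lfunE opp_lfunE gXY subrr.
Qed.

Lemma transp_linear (R : realType) (V : vectType R) (g : bform V) :
  inner_product g -> linear (transp g).
Proof.
move=> ig a A B; apply/lfunP => X; apply: (form_inj ig) => Y.
by rewrite !(transpE, linearP, add_lfunE, scale_lfunE).
Qed.

Lemma sympart_linear (R : realType) (V : vectType R) (g : bform V) :
  inner_product g -> linear (sympart g).
Proof.
move=> ig a A B; rewrite /sympart transp_linear // addrACA -scalerDr [LHS]scalerDr.
by rewrite !scalerA mulrC.
Qed.

(** Expanding the argument containing [A] or its transpose turns both sides into the double sum of
    [g (A e_i) e_k * f e_k e_i]. *)
Lemma sum_onb_transp (R : realType) (V : vectType R) (g : bform V)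
    (e : (\dim {:V}).-tuple V) (f : V -> V -> R) (A : 'End(V)) :
  inner_product g -> orthonormal_basis g e ->
  (forall X, linear_for *%R (f X)) -> (forall Y, linear_for *%R (f^~ Y)) ->
  \sum_(i < \dim {:V}) f (A e`_i) e`_i =
  \sum_(i < \dim {:V}) f e`_i (transp g A e`_i).
Proof.
move=> ig oe fr fl; have be := orthonormal_basis_of oe; have [gs _] := ig.
have fEl X Y : f X Y = \sum_(k < \dim {:V}) g X e`_k * f e`_k Y.
  rewrite -[LHS](linfunE (f := f^~ Y : V -> R^o) (fl Y)).
  rewrite {1}(coord_basis be (memvf X)) linear_sum; apply: eq_bigr => i _.
  by rewrite linearZ /= (linfunE (fl Y)) (coord_orthonormal oe).
have fEr X Y : f X Y = \sum_(k < \dim {:V}) g Y e`_k * f X e`_k.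
  rewrite -[LHS](linfunE (f := f X : V -> R^o) (fr X)).
  rewrite {1}(coord_basis be (memvf Y)) linear_sum; apply: eq_bigr => i _.
  by rewrite linearZ /= (linfunE (fr X)) (coord_orthonormal oe).
under eq_bigr do rewrite fEl.
rewrite exchange_big; apply: eq_bigr => i _ /=; rewrite fEr.
by apply: eq_bigr => j _; rewrite transpE // gs.
Qed.

Lemma dotE_transp (R : realType) (V : vectType R) (g : bform V) (A B : 'End(V)) :
  inner_product g -> dotE g (transp g A) B = dotE g A (transp g B).
Proof.
move=> ig; have oe := onbP ig; have [gs _] := ig.
rewrite !(dotE_onb _ _ ig oe).
under eq_bigr do rewrite transpE //.
rewrite -(sum_onb_transp (f := fun X Y => g (A X) Y) B ig oe).
- by apply: eq_bigr => i _; rewrite gs.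
- by move=> X a Y Z; rewrite linearP.
- by move=> X a Y Z; rewrite !linearP add_lfunE scale_lfunE.
Qed.

Lemma dotE_sympart (R : realType) (V : vectType R) (g : bform V) (A B : 'End(V)) :
  inner_product g -> dotE g (sympart g A) B = dotE g A (sympart g B).
Proof.
move=> ig; rewrite (linear_form_scaleD _ _ _ (dotE_linear_l B ig)).
by rewrite (linear_form_scaleD _ _ _ (dotE_linear_r A ig)) dotE_transp.
Qed.

(** * The inner product on brackets and the operator [delta] *)

Lemma dotBC (R : realType) (V : vectType R) (g : bform V) (mu la : bracket V) :
  inner_product g -> dotB g mu la = dotB g la mu.
Proof.
by move=> [gs _]; apply: eq_bigr => i _; apply: eq_bigr => j _; rewrite gs.
Qed.

Lemma dotB_linear_l (R : realType) (V : vectType R) (g : bform V) (la : bracket V) :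
  linear_for *%R (fun mu : bracket V => dotB g mu la).
Proof.
move=> a mu nu; rewrite /dotB mulr_sumr -big_split; apply: eq_bigr => i _ /=.
rewrite mulr_sumr -big_split; apply: eq_bigr => j _ /=.
by rewrite !(linearP, add_lfunE, scale_lfunE).
Qed.

Lemma dotB_linear_r (R : realType) (V : vectType R) (g : bform V) (mu : bracket V) :
  linear_for *%R (dotB g mu).
Proof.
move=> a la nu; rewrite /dotB mulr_sumr -big_split; apply: eq_bigr => i _ /=.
rewrite mulr_sumr -big_split; apply: eq_bigr => j _ /=.
by rewrite !(linearP, add_lfunE, scale_lfunE).
Qed.

Lemma delta_linear_l (R : realType) (V : vectType R) (A : 'End(V)) :
  linear (fun mu : bracket V => delta mu A).
Proof.
move=> a mu nu; apply/lfunP => X; apply/lfunP => Y.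
rewrite !(add_lfunE, scale_lfunE, deltaE) linearP opprD -scalerN.
exact: scale_add3.
Qed.

Lemma delta_id (R : realType) (V : vectType R) (mu : bracket V) :
  delta mu \1%VF = mu.
Proof.
by apply/lfunP => X; apply/lfunP => Y; rewrite deltaE !id_lfunE addrK.
Qed.

(** The identity holds separately for each of the three terms of [delta]: [sum_onb_transp] in the
    first or second slot of the brackets, and the definition of the transpose for the outer
    action. *)
Lemma dotB_delta_transp (R : realType) (V : vectType R) (g : bform V)
    (mu la : bracket V) (A : 'End(V)) :
  inner_product g -> dotB g (delta la A) mu = dotB g la (delta mu (transp g A)).
Proof.
move=> ig; have oe := onbP ig; have [gs _] := ig; rewrite /dotB; set e := onb g.
under eq_bigr do under eq_bigr do
  rewrite deltaE !(linearB, linearD) !(add_lfunE, opp_lfunE).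
under [RHS]eq_bigr do under eq_bigr do rewrite deltaE linearB linearD.
under eq_bigr do rewrite sumrB big_split.
under [RHS]eq_bigr do rewrite sumrB big_split.
rewrite /= !sumrB !big_split /=; congr (_ + _ - _).
- rewrite exchange_big [RHS]exchange_big; apply: eq_bigr => j _ /=.
  apply: (sum_onb_transp (f := fun X Y => g (la X e`_j) (mu Y e`_j)) A ig oe).
    by move=> X a Y Z; rewrite !(linearP, add_lfunE, scale_lfunE).
  by move=> X a Y Z; rewrite !(linearP, add_lfunE, scale_lfunE).
- apply: eq_bigr => i _ /=.
  apply: (sum_onb_transp (f := fun X Y => g (la e`_i X) (mu e`_i Y)) A ig oe).
    by move=> X a Y Z; rewrite !(linearP, add_lfunE, scale_lfunE).
  by move=> X a Y Z; rewrite !(linearP, add_lfunE, scale_lfunE).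
- by apply: eq_bigr => i _; apply: eq_bigr => j _; rewrite gs -transpE // gs.
Qed.

(** Both [sympart] and the pair [delta], [deltat] are moved across the inner product; this is the
    form in which the Laplacian appears when [Mop] is differentiated. *)
Lemma dotE_Lap (R : realType) (V : vectType R) (g : bform V) (mu : bracket V)
    (A E : 'End(V)) :
  inner_product g ->
  dotE g (Lap g mu A) E = dotB g (delta mu A) (delta mu (sympart g E)).
Proof. by move=> ig; rewrite dotE_sympart // deltatE. Qed.

Lemma delta_linear_r (R : realType) (V : vectType R) (mu : bracket V) :
  linear (delta mu).
Proof.
move=> a A B; apply/lfunP => X; apply/lfunP => Y.
rewrite !(add_lfunE, scale_lfunE, deltaE) !linearP /= !(add_lfunE, scale_lfunE).
rewrite ?opprD -?scalerN. exact: scale_add3.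
Qed.

Lemma delta_ad (R : realType) (V : vectType R) (mu : bracket V) (A : 'End(V)) (X : V) :
  delta mu A X = mu (A X) + ((mu X \o A)%VF - (A \o mu X)%VF).
Proof.
by apply/lfunP => Y; rewrite deltaE !(add_lfunE, opp_lfunE, comp_lfunE) addrA.
Qed.

Lemma lftrace_delta (R : realType) (V : vectType R) (mu : bracket V) (A : 'End(V))
    (X : V) :
  lftrace (delta mu A X) = lftrace (mu (A X)).
Proof. by rewrite delta_ad lftraceD lftraceB lftrace_comm subrr addr0. Qed.

(** The commutator terms add up to the trace of [[ad X ad Y, A]]: the two products with [A] in the
    middle cancel, and the remaining two have equal traces by cyclicity. *)
Lemma lftrace_comp_delta (R : realType) (V : vectType R) (mu : bracket V)
    (A : 'End(V)) (X Y : V) :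
  lftrace (delta mu A X \o mu Y)%VF + lftrace (mu X \o delta mu A Y)%VF =
  lftrace (mu (A X) \o mu Y)%VF + lftrace (mu X \o mu (A Y))%VF.
Proof.
rewrite !delta_ad !(comp_lfunDl, comp_lfunDr, comp_lfunNl, comp_lfunNr).
rewrite !lftraceD !lftraceN !comp_lfunA.
rewrite -(comp_lfunA A) (lftrace_comm A); ring.
Qed.

(** * Evolution of the three ingredients of the Ricci operator *)

Lemma has_deriv_Mop (R : realType) (V : vectType R) (g : bform V)
    (mu : R -> bracket V) (t : R) (A : 'End(V)) :
  inner_product g -> has_deriv mu t (delta (mu t) A) ->
  has_deriv (fun s => Mop g (mu s)) t (- (2^-1 *: Lap g (mu t) A)).
Proof.
move=> ig dmu; have iE := dotE_inner_product ig.
apply: (has_deriv_nondeg (inner_product_nondeg iE) (proj1 iE)) => E.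
rewrite (_ : (fun s => _) = fun s => - 4^-1 * dotB g (delta (mu s) E) (mu s));
  last by apply/funext => s; rewrite dotE_form ?MopE.
pose f (m l : bracket V) := - 4^-1 * dotB g (delta m E) l.
apply: is_derive_eq.
  apply: (is_derive_bilinear (f := f) _ _ dmu dmu) => [m|l] a x y; rewrite /f.
    by rewrite dotB_linear_r mulrDr mulrCA.
  by rewrite delta_linear_l dotB_linear_l mulrDr mulrCA.
rewrite linearN linearZ opp_lfunE scale_lfunE dotE_form // dotE_Lap // /f.
(* The two terms of the product rule become [<delta A, delta E^t>] and [<delta A, delta E>], all for
   [mu t]. Their sum is twice the pairing with [delta (sympart g E)], which turns the factor [- 1/4]
   into [- 1/2]. *)
rewrite dotB_delta_transp // [dotB g (delta (mu t) E) _]dotBC //.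
have fl : linear_for *%R (fun C => dotB g (delta (mu t) A) (delta (mu t) C)).
  by move=> a C D; rewrite delta_linear_r dotB_linear_r.
rewrite (linear_form_scaleD _ _ _ fl).
by rewrite /GRing.scale /=; field.
Qed.

Lemma has_deriv_Bop (R : realType) (V : vectType R) (g : bform V)
    (mu : R -> bracket V) (t : R) (A : 'End(V)) :
  inner_product g -> has_deriv mu t (delta (mu t) A) ->
  has_deriv (fun s => Bop g (mu s)) t
    ((Bop g (mu t) \o A)%VF + (transp g A \o Bop g (mu t))%VF).
Proof.
move=> ig dmu; have iE := dotE_inner_product ig; have oe := onbP ig; set e := onb g in oe.
apply: (has_deriv_nondeg (inner_product_nondeg iE) (proj1 iE)) => E.
(* The pairing of [Bop] with [E], written over the orthonormal basis and polarised in the bracket so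
   that the product rule applies. *)
pose f (m l : bracket V) := \sum_(i < \dim {:V}) lftrace (m e`_i \o l (E e`_i))%VF.
rewrite (_ : (fun s => _) = fun s => f (mu s) (mu s)); last first.
  apply/funext => s; rewrite dotE_form // (dotE_onb _ _ ig oe).
  by apply: eq_bigr => i _; rewrite BopE.
apply: is_derive_eq.
  apply: (is_derive_bilinear (f := f) _ _ dmu dmu) => [m|l] a x y.
    rewrite /f mulr_sumr -big_split; apply: eq_bigr => i _ /=.
    by rewrite add_lfunE scale_lfunE comp_lfunDr -comp_lfunZr lftrace_linear.
  rewrite /f mulr_sumr -big_split; apply: eq_bigr => i _ /=.
  by rewrite add_lfunE scale_lfunE comp_lfunDl -comp_lfunZl lftrace_linear.
rewrite dotE_form // (dotE_onb _ _ ig oe) -big_split; apply: eq_bigr => i _ /=.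
(* What remains of each summand is [g (B (A e_i)) (E e_i) + g (B e_i) (A (E e_i))]; transposing the
   last [A] gives the claimed operator. *)
rewrite lftrace_comp_delta add_lfunE linearD add_lfunE.
rewrite [(Bop g _ \o A)%VF _]comp_lfunE [(transp g A \o _)%VF _]comp_lfunE.
by rewrite transpE // !BopE.
Qed.

(** The derivative pairs with [X] as the trace of [ad (A X)], that is [g H (A X)], since the
    commutator has trace zero. *)
Lemma has_deriv_Hvec (R : realType) (V : vectType R) (g : bform V)
    (mu : R -> bracket V) (t : R) (A : 'End(V)) :
  inner_product g -> has_deriv mu t (delta (mu t) A) ->
  has_deriv (fun s => Hvec g (mu s)) t (transp g A (Hvec g (mu t))).
Proof.
move=> ig dmu; apply: (has_deriv_nondeg (inner_product_nondeg ig) (proj1 ig)) => X.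
rewrite (_ : (fun s => _) = fun s => lftrace (mu s X)); last first.
  by apply/funext => s; rewrite HvecE.
rewrite transpE // HvecE // -lftrace_delta.
apply: (is_derive_linear (f := fun m : bracket V => lftrace (m X)) _ dmu).
by move=> a x y; rewrite add_lfunE scale_lfunE lftrace_linear.
Qed.

Lemma has_deriv_Ric (R : realType) (V : vectType R) (g : bform V)
    (mu : R -> bracket V) (t : R) (A : 'End(V)) (H := Hvec g (mu t))
    (B := Bop g (mu t)) :
  inner_product g -> has_deriv mu t (delta (mu t) A) ->
  has_deriv (fun s => Ric g (mu s)) t
    (- (2^-1 *: Lap g (mu t) A)
     - 2^-1 *: ((B \o A)%VF + (transp g A \o B)%VF)
     - 2 *: sympart g (mu t (sympart g A H))
     - sympart g ((mu t H \o A)%VF - (A \o mu t H)%VF)).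
Proof.
(* The last two terms are gathered under a single [sympart], to be recognised as the derivative of
   the symmetrised [ad H]. *)
move=> ig dmu; rewrite -[_ - sympart g (_ - _)]addrA -[- (2 *: _) - _]opprD -sympart_linear //.
(* The right side is the product rule for [mu s (Hvec g (mu s))]. It contains
   [ad (A H) + ad (A^t H)], and [A H + A^t H] is twice [sympart g A H]: hence the factor [2]. *)
have -> : 2 *: mu t (sympart g A H) + ((mu t H \o A)%VF - (A \o mu t H)%VF) =
    delta (mu t) A H + mu t (transp g A H).
  rewrite delta_ad addrAC; congr (_ + _); rewrite /sympart.
  by rewrite scale_lfunE linearZ scalerA divff ?pnatr_eq0 // scale1r add_lfunE linearD.
apply: has_derivB; first apply: has_derivB.
- exact: has_deriv_Mop.
- apply: (has_deriv_linear (f := *:%R 2^-1) _ (has_deriv_Bop ig dmu)) => a x y.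
  by rewrite linearP.
- apply: (has_deriv_linear (f := sympart g) (c := fun s => mu s (Hvec g (mu s)))).
    exact: sympart_linear.
  apply: (has_deriv_bilinear (f := fun (m : bracket V) X => m X) _ _ dmu
    (has_deriv_Hvec ig dmu)) => x a y z; first by rewrite linearP.
  by rewrite add_lfunE scale_lfunE.
Qed.

(** * Traces of the evolution terms and the final equations *)

Lemma transp_Bop (R : realType) (V : vectType R) (g : bform V) (mu : bracket V) :
  inner_product g -> transp g (Bop g mu) = Bop g mu.
Proof.
move=> ig; apply/lfunP => X; apply: (form_inj ig) => Y.
by rewrite transpE // (proj1 ig) !BopE // lftrace_comm.
Qed.

Lemma transp_id (R : realType) (V : vectType R) (g : bform V) :
  inner_product g -> transp g \1%VF = \1%VF.
Proof.
by move=> ig; apply/lfunP => X; apply: (form_inj ig) => Y; rewrite transpE ?id_lfunE.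
Qed.

(** Reading the trace as a pairing with the identity makes the trace formulas below instances of the
    adjunction rules. *)
Lemma dotE_id (R : realType) (V : vectType R) (g : bform V) (A : 'End(V)) :
  inner_product g -> dotE g A \1%VF = lftrace A.
Proof. by move=> ig; rewrite /dotE transp_id // comp_lfun1r. Qed.

Lemma sympart_id (R : realType) (V : vectType R) (g : bform V) :
  inner_product g -> sympart g \1%VF = \1%VF.
Proof.
move=> ig; rewrite /sympart transp_id // -[X in _ *: (X + X)]scale1r -scalerDl.
by rewrite scalerA mulVf ?pnatr_eq0 // scale1r.
Qed.

Lemma lftrace_sympart (R : realType) (V : vectType R) (g : bform V) (A : 'End(V)) :
  inner_product g -> lftrace (sympart g A) = lftrace A.
Proof. by move=> ig; rewrite -!(dotE_id _ ig) dotE_sympart // sympart_id. Qed.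

Lemma dotB_delta_self (R : realType) (V : vectType R) (g : bform V) (mu : bracket V)
    (A : 'End(V)) :
  inner_product g -> dotB g (delta mu A) mu = - 4 * dotE g A (Mop g mu).
Proof. by move=> ig; rewrite dotEC // MopE //; field. Qed.

(** Pairing with the identity, which is its own symmetric part and satisfies [delta mu \1 = mu],
    leaves [<delta mu A, mu>]. *)
Lemma lftrace_Lap (R : realType) (V : vectType R) (g : bform V) (mu : bracket V)
    (A : 'End(V)) :
  inner_product g -> lftrace (Lap g mu A) = - 4 * dotE g A (Mop g mu).
Proof.
by move=> ig; rewrite -(dotE_id _ ig) dotE_Lap // sympart_id // delta_id dotB_delta_self.
Qed.

Theorem proposition6p4 (R : realType) (n : nat) (pq : pq_rule R n)
    (V : vectType R) (omega0 g0 : bform V) (I : set R) (mu : R -> bracket V)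
    (dimV : \dim {:V} = n.*2) (ah0 : almost_hermitian omega0 g0)
    (openI : open I) (itvI : is_interval I)
    (flow : bracket_flow pq omega0 g0 I mu) (t : R) (It : I t) :
  let A : 'End(V) := PQac pq omega0 g0 (mu t) in
  let B : 'End(V) := Bop g0 (mu t) in
  let H : V := Hvec g0 (mu t) in
  let M : 'End(V) := Mop g0 (mu t) in
  let ad : V -> 'End(V) := fun X => mu t X in
  let At : 'End(V) := transp g0 A in
  [/\ has_deriv (fun s : R => Ric g0 (mu s)) t
        (- (2^-1 *: Lap g0 (mu t) A)
         - 2^-1 *: ((B \o A)%VF + (At \o B)%VF)
         - 2 *: sympart g0 (ad (sympart g0 A H))
         - sympart g0 ((ad H \o A)%VF - (A \o ad H)%VF)),
      is_derive (t : R^o) (1 : R^o) (fun s : R^o => scal g0 (mu s) : R^o)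
        (2 * dotE g0 A (Ric g0 (mu t))
         + 2 * dotE g0 A (sympart g0 (ad H))
         - 2 * (g0 (A H) H : R))
    & is_derive (t : R^o) (1 : R^o) (fun s : R^o => dotB g0 (mu s) (mu s) : R^o)
        (- 8 * dotE g0 A M)].
Proof.
move=> A B H M ad At; have [_ _ ig _] := ah0; have [gs _] := ig.
have [_ dmu] := flow t It; rewrite -/A in dmu.
have dRic := has_deriv_Ric ig dmu; split=> //.
- apply: is_derive_eq.
    exact: (is_derive_linear (@lftrace_linear R V) dRic).
  rewrite 3!lftraceB lftraceN (lftraceZ _ (Lap _ _ _)) lftrace_Lap //.
  rewrite (lftraceZ _ (_ + _)) lftraceD (lftraceZ _ (sympart _ _)) !lftrace_sympart //.
  rewrite lftraceB (lftrace_comm (mu t _)) subrr.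
  (* The commutator has just dropped out; the trace of [ad (S(A) H)] is [g H (S(A) H)], and only the
     symmetric part of [A] enters [g (A H) H]. *)
  rewrite -(HvecE _ ig) -/H gs.
  have -> : g0 (sympart g0 A H) H = g0 (A H) H.
    rewrite /sympart scale_lfunE add_lfunE linearZ scale_lfunE linearD add_lfunE.
    by rewrite transpE // [g0 H _]gs /GRing.scale /=; field.
  have AB : lftrace (B \o A)%VF = dotE g0 A B.
    by rewrite /dotE transp_Bop // lftrace_comm.
  have BA : lftrace (At \o B)%VF = dotE g0 A B.
    by rewrite lftrace_comm dotEC.
  (* The trace is now [2 <A, M> - <A, B> - 2 g (A H) H]. Since [Ric] is [M - B/2 - S(ad H)], the
     second term of the claim compensates for [S(ad H)]. *)
  rewrite AB BA /Ric -/M -/B -/H.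
  by rewrite !dotEBr // dotEZr // /ad; field.
- apply: is_derive_eq.
    apply: (is_derive_bilinear (f := dotB g0) _ _ dmu dmu).
      exact: dotB_linear_r.
    exact: dotB_linear_l.
  (* By symmetry both terms of the product rule equal [- 4 <A, M>]. *)
  rewrite [dotB g0 (mu t) _]dotBC // dotB_delta_self //.
  ring.
Qed.
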